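(* Let $\mathcal{P}$ be the PAG over the observed variables $\mathbf{O}$ and let $(X,Y)$ be an ordered pair of target variables. Then $X$ has no causal effect on $Y$ if there exist a subset $\mathbf{Z}\subseteq\mathrm{MB}(X)$ with $\mathbf{Z}\cap\mathrm{PossDe}(X,\mathcal{P})=\emptyset$ and a variable $S\in\mathrm{MB}(X)\setminus(\{Y\}\cup\mathrm{Ch}(X,\mathcal{P}))$ such that at least one of the following holds: (i) $X\perp\!\!\!\perp Y\mid\mathbf{Z}$; or (ii) $S\not\perp\!\!\!\perp X\mid\mathbf{Z}$ and $S\perp\!\!\!\perp Y\mid\mathbf{Z}$.
   Context: Setting: a structural causal model over $\mathbf{V}=\mathbf{O}\cup\mathbf{U}$ ($\mathbf{O}$ observed, $\mathbf{U}$ latent) with acyclic causal DAG $D$, each $V_i=f_i(\mathrm{Pa}(V_i,D),\varepsilon_i)$ with independent errors, satisfying causal Markov and faithfulness; conditional independences ($\perp\!\!\!\perp$) among observed variables coincide with m-separations in the MAG over $\mathbf{O}$ obtained by marginalizing latents. The PAG $\mathcal{P}$ represents its Markov equivalence class (marks tail/arrowhead if so in all equivalent MAGs, circle $\circ$ otherwise). $\mathrm{Ch}(X,\mathcal{P})$ is the set of $V$ with $X\to V$ in $\mathcal{P}$. A possibly directed path from $A$ to $B$ is a path on which no edge has an arrowhead at the mark nearer to $A$; $\mathrm{PossDe}(A,\mathcal{P})$ is the set of possible descendants of $A$. $\mathrm{MB}(X)$ is the Markov blanket of $X$ (smallest set rendering $X$ independent of all other observed variables; in the MAG: parents, children, children's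 parents, districts of $X$ and of its children (vertices reachable by bidirected edges only), and parents of those district vertices). ''$X$ has no causal effect on $Y$'' means the total causal effect is zero, i.e. $f(y\mid do(x))$ does not depend on $x$ (no directed path from $X$ to $Y$ in $D$). *)

(* Defs.v *)
From mathcomp Require Import all_boot.
From mathcomp Require Import boolp.

Set Implicit Arguments.
Unset Strict Implicit.
Unset Printing Implicit Defensive.

(* A mixed graph on a finite vertex type: (directed edges u -> v, bidirected edges u <-> v). *)
Definition mixed (T : finType) := (rel T * rel T)%type.

Section CausalGraphs.
Variable T : finType.
Implicit Types (G : mixed T) (D : rel T) (O Z A B M : {set T}).

Definition adj G u v := [|| G.1 u v, G.1 v u, G.2 u v | G.2 v u].
Definition arrow_at G u v := [|| G.1 u v, G.2 u v | G.2 v u].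

Definition dag_mixed D : mixed T := (D, fun _ _ => false).

Definition acyclic_dag D := forall u v, D u v -> ~~ connect D v u.

Definition gpath G a b (t : seq T) :=
  [&& path (adj G) a t, uniq (a :: t) & last a t == b].

Definition collider_at G a (t : seq T) i :=
  arrow_at G (nth a (a :: t) i.-1) (nth a (a :: t) i) &&
  arrow_at G (nth a (a :: t) i.+1) (nth a (a :: t) i).

Definition anc_of_set G v Z := [exists z in Z, connect G.1 v z].

(* m-connecting path between a and b given Z (interior vertices are 0 < i < size t) *)
Definition mconnecting G a b Z : Prop :=
  exists t, gpath G a b t /\
    forall i, 0 < i < size t ->
      if collider_at G a t i then anc_of_set G (nth a (a :: t) i) Z
      else nth a (a :: t) i \notin Z.

(* m-separation; a vertex in the conditioning set is (trivially) separated *)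
Definition msep G a b Z : Prop := a \in Z \/ b \in Z \/ ~ mconnecting G a b Z.
Definition msepS G A B Z : Prop := forall a b, a \in A -> b \in B -> msep G a b Z.

(* inducing path in D relative to the latent set ~: O (no selection variables) *)
Definition inducing D O a b : Prop :=
  exists t, gpath (dag_mixed D) a b t /\
    forall i, 0 < i < size t ->
      (nth a (a :: t) i \in O -> collider_at (dag_mixed D) a t i) /\
      (collider_at (dag_mixed D) a t i ->
         connect D (nth a (a :: t) i) a || connect D (nth a (a :: t) i) b).

Definition mag_of D O : mixed T :=
  (fun u v => [&& u \in O, v \in O, u != v, `[< inducing D O u v >] & connect D u v],
   fun u v => [&& u \in O, v \in O, u != v, `[< inducing D O u v >],
                  ~~ connect D u v & ~~ connect D v u]).

Definition is_MAG O G : Prop :=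
  [/\ (forall u v, adj G u v -> (u \in O) && (v \in O)),
      (forall u, ~~ G.1 u u && ~~ G.2 u u),
      (forall u v, G.2 u v = G.2 v u) &
      (forall u v, G.1 u v -> ~~ G.1 v u && ~~ G.2 u v)] /\
  [/\ (forall u v, G.1 u v -> ~~ connect G.1 v u),
      (forall u v, G.2 u v -> ~~ connect G.1 u v) &
      (forall a b, a \in O -> b \in O -> a != b -> ~~ adj G a b ->
         exists Z, [/\ Z \subset O, a \notin Z, b \notin Z & msep G a b Z])].

Definition markov_equiv O G1 G2 : Prop :=
  forall a b Z, a \in O -> b \in O -> Z \subset O -> (msep G1 a b Z <-> msep G2 a b Z).

Definition in_pag_class D O G : Prop := is_MAG O G /\ markov_equiv O G (mag_of D O).

(* PAG marks: mark at v on the edge u -- v *)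
Definition pag_adj D O u v := adj (mag_of D O) u v.
Definition pag_arrowhead D O u v : Prop :=
  forall G, in_pag_class D O G -> arrow_at G u v.
Definition pag_tail D O u v : Prop :=
  forall G, in_pag_class D O G -> G.1 v u.

Definition pag_child D O X v : Prop :=
  [/\ pag_adj D O X v, pag_tail D O v X & pag_arrowhead D O X v].
Definition pag_Ch D O X : {set T} := [set v | `[< pag_child D O X v >]].

(* edge u -- v with no arrowhead at u (the end nearer to the start of the path) *)
Definition possdir_edge D O : rel T :=
  fun u v => pag_adj D O u v && ~~ `[< pag_arrowhead D O v u >].
Definition PossDe D O X : {set T} := [set v | connect (possdir_edge D O) X v].

(* conditional independences among observed variables coincide with
   m-separations in the MAG (causal Markov + faithfulness) *)
Definition ci_matches_mag D O (indep : {set T} -> {set T} -> {set T} -> Prop) : Prop :=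
  forall A B Z, A \subset O -> B \subset O -> Z \subset O ->
    (indep A B Z <-> msepS (mag_of D O) A B Z).

Definition blanket_cond O (indep : {set T} -> {set T} -> {set T} -> Prop) X M : Prop :=
  M \subset O :\ X /\ indep [set X] (O :\: (X |: M)) M.
Definition is_markov_blanket O indep X M : Prop :=
  blanket_cond O indep X M /\ forall M', blanket_cond O indep X M' -> M \subset M'.

Definition no_causal_effect D X Y : Prop := ~~ connect D X Y.

End CausalGraphs.

(* Main.v *)
(* If [X] is an ancestor of [Y] in the DAG, the MAG contains a directed path from
   [X] to [Y]. Since the MAG belongs to its own PAG class, that path stays in the
   possible descendants of [X], hence avoids [Z]; it therefore connects [X] to [Y],
   and extends any path connecting [S] to [X], as [X] is left through a tail. The
   real work is that the marginal graph is a MAG, i.e. is maximal: if [a], [b] are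
   joined by a path connecting given their other observed ancestors, then every
   inner vertex is an ancestor of [a] or [b], hence a collider, and the inducing
   paths of the edges merge into a walk of such ancestors in the DAG, which can be
   cut down to an inducing path between [a] and [b]. *)

Require Import Defs.
From mathcomp Require Import all_boot.
From mathcomp Require Import boolp.
From mathcomp Require Import zify.

Set Implicit Arguments.
Unset Strict Implicit.
Unset Printing Implicit Defensive.

(** * Walks with a condition on each inner vertex and its two neighbours *)

Section InnerTriples.
Variables (T : eqType) (P : T -> T -> T -> bool).

(** Recursion replaces the indices of [collider_at], so that concatenation and reversal are easy to
    handle. *)
Fixpoint inner x (t : seq T) : bool :=
  if t is y :: t' then (if t' is z :: _ then P x y z else true) && inner y t'
  else true.

Lemma innerP a t :
  reflect (forall i, 0 < i < size t ->
    P (nth a (a :: t) i.-1) (nth a (a :: t) i) (nth a (a :: t) i.+1))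
  (inner a t).
Proof.
(* The default of [nth] is split off from the start of the walk, which varies in the induction. *)
move: {1 3 5}a => d.
elim: t a => [|y [|z t] IH] a.
- by apply: ReflectT => -[].
- by apply: ReflectT => -[|[]].
rewrite [inner a _]/=; apply: (iffP andP) => [[Pa /IH H] [|[|i]] //=|H].
  by move=> lti; apply: (H i.+1).
split; first exact: (H 1).
by apply/IH => -[|i] //= lti; apply: (H i.+2).
Qed.

Lemma inner_cat x s y z t :
  inner x (rcons s y ++ z :: t) =
  [&& inner x (rcons s y), P (last x s) y z & inner y (z :: t)].
Proof.
elim: s x => [|w s IH] x //.
rewrite rcons_cons cat_cons [last _ _]/=.
have innerE u v r : inner u (v :: r) =
    (if r is q :: _ then P u v q else true) && inner v r by [].
by rewrite !innerE IH andbA; case: s {IH}.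
Qed.

Lemma inner_catl x s t : inner x (s ++ t) -> inner x s.
Proof.
case/lastP: s => // s y; case: t => [|z t]; first by rewrite cats0.
by rewrite inner_cat => /and3P[].
Qed.

Lemma inner_catr x s y t : inner x (rcons s y ++ t) -> inner y t.
Proof. by case: t => // z t; rewrite inner_cat => /and3P[]. Qed.

Lemma inner_rev x t :
  (forall u v w, P u v w -> P w v u) ->
  inner x t -> inner (last x t) (rev (belast x t)).
Proof.
move=> Psym; elim: t x => // y [|z t] IH x // /andP[Pxyz /IH].
rewrite [belast x _]/= [last x _]/= [belast y _]/= [last y _]/= !rev_cons.
rewrite -(cats1 _ x) inner_cat => -> /=; rewrite andbT; apply: Psym.
by case: t {IH} => [|w t] //=; rewrite rev_cons last_rcons.
Qed.

Lemma not_uniq_split (s : seq T) : ~~ uniq s ->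
  exists v s1 s2 s3, s = s1 ++ v :: s2 ++ v :: s3.
Proof.
elim: s => //= x s IH; rewrite negb_and negbK; case/orP => [xs|/IH].
  by case/splitPr: xs => p1 p2; exists x, [::], p1, p2.
by move=> [v [s1 [s2 [s3 ->]]]]; exists v, (x :: s1), s2, s3.
Qed.

(** Cutting out the loop between two visits of [v] creates a single new triple, made of the entry to
    the first visit and the exit from the second; the hypothesis on [P] covers it. *)
Lemma walk_to_path (e : rel T) a t :
  (forall x y x' y' v, P x v y -> P x' v y' -> P x v y') ->
  path e a t -> inner a t ->
  exists t', [/\ path e a t', inner a t', uniq (a :: t'),
    last a t' = last a t & {subset t' <= t}].
Proof.
move=> Pcut; have [n] := ubnP (size t).
elim: n t => // n IH t; rewrite ltnS => szt pat iat.
have [ut|/not_uniq_split[v [s1 [s2 [s3]]]]] := boolP (uniq (a :: t)).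
  by exists t; split.
suff step t' : size t' < size t -> path e a t' -> inner a t' ->
    last a t' = last a t -> {subset t' <= t} ->
    exists t', [/\ path e a t', inner a t', uniq (a :: t'),
      last a t' = last a t & {subset t' <= t}].
  (* If the repeated vertex is the start, the cut creates no new triple. *)
  case: s1 => [[av tE]|x s1 [_ tE]].
    have pv : path e v s3.
      by move: pat; rewrite tE -cat_rcons cat_path last_rcons => /andP[].
    have iv : inner v s3.
      by move: iat; rewrite tE -cat_rcons => /inner_catr.
    apply: (step s3).
    - by rewrite tE size_cat /=; lia.
    - by rewrite av.
    - by rewrite av.
    - by rewrite tE last_cat /= av.
    - by move=> w ws; rewrite tE mem_cat inE ws !orbT.
  apply: (step (s1 ++ v :: s3)).
  - by rewrite tE !size_cat /= size_cat /=; lia.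
  - move: pat; rewrite tE !cat_path /= cat_path /=.
    by move=> /and3P[-> -> /and3P[_ _ ->]].
  - move: iat; rewrite tE -!cat_rcons.
    case: s3 {tE} => [|z s3]; first by rewrite !cats0 => /inner_catl.
    rewrite catA -rcons_cat inner_cat rcons_cat => /and3P[i1 P2 i3].
    rewrite inner_cat (inner_catl i1) i3 andbT /=.
    case: s2 i1 P2 => [|w s2]; rewrite ?cats0 ?rcons_cons /=.
      rewrite last_rcons inner_cat => /and3P[_ P1 _] P2.
      exact: Pcut P1 P2.
    rewrite inner_cat => /and3P[_ P1 _] P2; exact: Pcut P1 P2.
  - by rewrite tE !last_cat /= last_cat.
  - move=> w; rewrite tE !mem_cat !inE mem_cat inE.
    by case/or3P=> ->; rewrite ?orbT.
move=> szt' pat' iat' lt' st'.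
have [u [? ? ? lu su]] := IH t' (leq_trans szt' szt) pat' iat'.
by exists u; split=> //; [rewrite lu | move=> w /su /st'].
Qed.

End InnerTriples.

Lemma path_connect_last (T : finType) (e : rel T) x p w :
  path e x p -> w \in x :: p -> connect e w (last x p).
Proof.
move=> xp wp; case/splitPl: wp xp => p1 p2 lp1.
rewrite cat_path lp1 last_cat lp1 => /andP[_ wp2].
by apply/connectP; exists p2.
Qed.

(** * Ancestors along walks in a mixed graph *)

Section MixedGraphs.
Variables (T : finType) (G : mixed T).

Definition collider x v y := arrow_at G x v && arrow_at G y v.

Lemma adj_sym u v : adj G u v = adj G v u.
Proof. by rewrite /adj orbCA (orbC (G.2 u v)). Qed.

Lemma no_arrow_at_edge u v : adj G u v -> ~~ arrow_at G v u -> G.1 u v.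
Proof. by rewrite /arrow_at; case/or4P => -> //; rewrite ?orbT. Qed.

(* A vertex with a tail on a path starts a directed walk that ends at a
   collider or at an endpoint of the path. *)
Lemma walk_ancestors (A : pred T) x t :
  (forall u v, G.1 u v -> A v -> A u) ->
  path (adj G) x t -> inner (fun x v y => collider x v y ==> A v) x t ->
  A x -> A (last x t) -> all A (x :: t).
Proof.
move=> Acl.
have forward y s : path (adj G) y s ->
    inner (fun x v y => collider x v y ==> A v) y s -> A (last y s) ->
    (if s is z :: _ then ~~ arrow_at G z y else true) -> A y.
  elim: s y => [|z s IH] y //= /andP[yz pzs] /andP[cz izs] Al nzy.
  have Gyz := no_arrow_at_edge yz nzy; apply: (Acl _ _ Gyz).
  case: s IH pzs cz izs Al => [//|w s] IH pzs cz izs Al.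
  have [wz|nwz] := boolP (arrow_at G w z); last exact: IH.
  by move: cz; rewrite /collider wz /arrow_at Gyz.
elim: t x => [|y t IH] x; first by move=> _ _ /= ->.
move=> p i Ax Al; apply/andP; split=> //.
case/andP: p => xy pyt; case/andP: i => cy iyt.
apply: IH => //.
(* A tail at [y] makes [y] a parent of [x]. Otherwise [y] is a collider, the endpoint, or is left
   through a tail, where [forward] applies. *)
have [axy|naxy] := boolP (arrow_at G x y); last first.
  by apply: Acl Ax; apply: no_arrow_at_edge naxy; rewrite adj_sym.
case: t cy pyt iyt Al => [//|z t] cy pyt iyt Al.
have [azy|nazy] := boolP (arrow_at G z y); last exact: (forward y (z :: t)).
by move: cy; rewrite /collider axy azy.
Qed.

End MixedGraphs.

(** * Inducing paths in the DAG *)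

Section MarginalMAG.
Variables (T : finType) (D : rel T) (O : {set T}).
Hypothesis HD : acyclic_dag D.

Let GD := dag_mixed D.
Let M := mag_of D O.

Definition latent_or_collider x v y := (v \in O) ==> collider GD x v y.

Definition anc2 a b v := connect D v a || connect D v b.

Lemma arrow_at_dag u v : arrow_at GD u v = D u v.
Proof. by rewrite /arrow_at orbF. Qed.

Lemma connect_antisym u v : connect D u v -> connect D v u -> u = v.
Proof.
case/connectP=> -[//|w p] /= /andP[uw pw] vE vu.
have wv : connect D w v by apply/connectP; exists p.
by have := HD uw; rewrite (connect_trans wv vu).
Qed.

(** Loops may be cut: at an observed vertex both triples are colliders, hence so is the new one, and
    ancestry is asked of every vertex, so it survives deletions. *)
Lemma inducing_walk a b t :
  path (adj GD) a t -> last a t = b -> all (anc2 a b) (a :: t) ->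
  inner latent_or_collider a t -> inducing D O a b.
Proof.
move=> pat lat At iat.
have [|u [pau iau uau lau su]] := @walk_to_path _ latent_or_collider _ a t _ pat iat.
  move=> x y x' y' v; rewrite /latent_or_collider /collider.
  by case: (v \in O) => //= /andP[-> _] /andP[_ ->].
exists u; split; first by rewrite /gpath pau uau lau lat eqxx.
move/innerP: iau => iau i ltiu; split; first exact/implyP/iau.
move=> _; case: i ltiu => // i ltiu.
by move/allP: At => /(_ (nth a u i)); apply; rewrite inE su ?orbT // mem_nth // ltnW.
Qed.

(** Ancestry passes from the colliders and endpoints to all vertices by [walk_ancestors]. *)
Lemma inducingE a b : inducing D O a b ->
  exists t, [/\ path (adj GD) a t, last a t = b, all (anc2 a b) (a :: t)
    & inner latent_or_collider a t].
Proof.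
case=> t [/and3P[pat _ /eqP lat] it]; exists t; split=> //.
  apply: (@walk_ancestors _ GD) => //.
  - move=> u v Duv; rewrite /anc2.
    by case/orP => /(connect_trans (connect1 Duv)) ->; rewrite ?orbT.
  - by apply/innerP => i lti; apply/implyP; case: (it i lti) => _; apply.
  - by rewrite /anc2 connect0.
  - by rewrite lat /anc2 connect0 orbT.
by apply/innerP => i lti; apply/implyP; case: (it i lti) => + _; apply.
Qed.

Lemma inducing_sym a b : inducing D O a b -> inducing D O b a.
Proof.
case/inducingE => t [pat lat At it].
apply: (@inducing_walk _ _ (rev (belast a t))).
- rewrite -lat rev_path; apply: sub_path pat => x y; by rewrite adj_sym.
- by rewrite -lat; case: (t) => //= x s; rewrite rev_cons last_rcons.
- apply/allP=> v; rewrite -lat -rev_rcons -lastI mem_rev => /(allP At).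
  by rewrite /anc2 orbC lat.
- rewrite -lat; apply: inner_rev it => x v y.
  by rewrite /latent_or_collider /collider andbC.
Qed.

(** * The marginal graph is a MAG *)

Lemma adj_magE u v :
  adj M u v <-> [/\ u \in O, v \in O, u != v & inducing D O u v].
Proof.
split.
  case/or4P => /and5P[uO vO neq /asboolP ind _]; split=> //;
    try exact: inducing_sym; by rewrite eq_sym.
case=> uO vO neq ind; have ind' := inducing_sym ind.
rewrite /adj /= uO vO neq eq_sym neq.
rewrite (asboolT ind) (asboolT ind') /=.
by case: (connect D u v); case: (connect D v u).
Qed.

Lemma mag_arrow u v : arrow_at M u v -> ~~ connect D v u.
Proof.
case/or3P.
- case/and5P=> _ _ neq _ uv; apply/negP => /(connect_antisym uv) uE.
  by rewrite uE eqxx in neq.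
- by case/and5P => _ _ _ _ /andP[].
- by case/and5P => _ _ _ _ /andP[].
Qed.

Lemma mag_directed_sub u v : connect M.1 u v -> connect D u v.
Proof.
apply: connect_sub => x y; by case/and5P.
Qed.

(** Were [x] left through a tail, the next vertex would be a descendant of [x] and an ancestor of
    [x] or [y], giving a cycle or a directed path from [x] to [y]. *)
Lemma inducing_into x y w : all (anc2 x y) w -> path (adj GD) x w ->
  0 < size w -> ~~ connect D x y -> D (head x w) x.
Proof.
case: w => // z w /= /andP[Az _] /andP[xz _] _ nxy.
rewrite -arrow_at_dag; apply: contraT => nzx.
have Dxz : D x z := no_arrow_at_edge xz nzx.
case/orP: Az => [zx|zy]; first by have := HD Dxz; rewrite zx.
by rewrite (connect_trans (connect1 Dxz) zy) in nxy.
Qed.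

(* Inducing paths of consecutive edges are concatenated: an inducing path
   between [u] and [v] is into [v] unless [v] is an ancestor of [u], so every
   junction is a collider. *)
Lemma collider_path_walk a b x t : path (adj M) x t -> 0 < size t ->
  inner (collider M) x t -> all (anc2 a b) (x :: t) ->
  exists w, [/\ path (adj GD) x w, last x w = last x t, 0 < size w,
    all (anc2 a b) (x :: w) & inner latent_or_collider x w /\
    (arrow_at M (head x t) x -> D (head x w) x)].
Proof.
elim: t x => // y t IH x /andP[/adj_magE[xO yO neq ind] pyt] _ ixt.
case/and3P=> Ax Ay At.
have [w [pw lw Aw iw]] := inducingE ind.
have sub v : anc2 x y v -> anc2 a b v.
  by move/orP=> [] vx; [move: Ax | move: Ay]; case/orP=> H;
     rewrite /anc2 (connect_trans vx H) ?orbT.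
have Aw' : all (anc2 a b) w.
  by apply/allP => v vw; apply: sub; apply: (allP Aw); rewrite inE vw orbT.
case/lastP: w => [|w z] in pw lw Aw iw Aw' *.
  by rewrite -lw eqxx in neq.
move: lw; rewrite last_rcons => zy; subst z.
have into : arrow_at M y x -> D (head x (rcons w y)) x.
  move/mag_arrow => nxy; apply: inducing_into nxy => //; last by rewrite size_rcons.
  by case/andP: Aw.
case: t => [|z t] in IH pyt ixt At *.
  exists (rcons w y); split=> //; rewrite ?last_rcons ?size_rcons //=.
  by rewrite Ax.
case/andP: ixt => /andP[axy azy] iyt.
have [|u [pu lu su Au [iu into_u]]] := IH y pyt isT iyt.
  by rewrite /= Ay.
exists (rcons w y ++ u); split.
- by rewrite cat_path pw last_rcons.
- by rewrite last_cat last_rcons.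
- by rewrite size_cat size_rcons.
- by rewrite /= all_cat Ax Aw' /=; case/andP: Au.
split; last by move/into; case: (w).
case: u {lu Au} => // v u in pu su iu into_u *.
rewrite inner_cat iw iu andbT /=; apply/implyP => _.
rewrite /collider !arrow_at_dag (into_u azy) andbT.
(* The reversal of the first piece runs from [y] to [x]; the arrowhead at [y] in the MAG says that
   [y] is no ancestor of [x], so this piece also points into [y]. *)
have := @inducing_into y x (rev (belast x (rcons w y))).
rewrite belast_rcons rev_cons.
have -> : head y (rcons (rev w) x) = last x w.
  by case/lastP: (w) => //= s q; rewrite last_rcons rev_rcons.
apply.
- rewrite -rev_cons all_rev -(belast_rcons x w y); apply/allP => q /mem_belast.
  by move/(allP Aw); rewrite /anc2 orbC.
- rewrite -rev_cons -(belast_rcons x w y) -[X in path _ X](last_rcons x w y) rev_path.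
  by apply: sub_path pw => p q; rewrite adj_sym.
- by rewrite size_rcons.
exact: mag_arrow.
Qed.

Lemma mag_is_MAG : is_MAG O M.
Proof.
split; split.
- by move=> u v /adj_magE[-> ->].
- by move=> u; rewrite /= eqxx !andbF.
- move=> u v /=; apply/and5P/and5P => -[uO vO neq /asboolP ind /andP[n1 n2]];
  by split; rewrite ?n1 ?n2 // 1?eq_sym //; apply/asboolP/inducing_sym.
- move=> u v /and5P[_ _ neq _ uv].
  apply/andP; split; apply/negP => /and5P[_ _ _ _].
    by move/(connect_antisym uv) => uE; rewrite uE eqxx in neq.
  by rewrite uv.
- move=> u v /and5P[_ _ neq _ uv]; apply/negP => /mag_directed_sub.
  by move/(connect_antisym uv) => uE; rewrite uE eqxx in neq.
- move=> u v /and5P[_ _ _ _ /andP[nuv _]].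
  by apply: contra nuv; apply: mag_directed_sub.
move=> a b aO bO neq nadj.
pose Z := [set v in O | [&& anc2 a b v, v != a & v != b]].
exists Z; split; [| by rewrite inE eqxx /= !andbF | by rewrite inE eqxx !andbF |].
  by apply/subsetP => v; rewrite inE => /andP[].
right; right=> -[t [/and3P[pat uat /eqP lat] it]].
have Acl u v : M.1 u v -> anc2 a b v -> anc2 a b u.
  case/and5P=> _ _ _ _ uv /orP[] /(connect_trans uv) H.
    by rewrite /anc2 H.
  by rewrite /anc2 H orbT.
have At : all (anc2 a b) (a :: t).
  apply: (@walk_ancestors _ M) => //; last 2 first.
  - by rewrite /anc2 connect0.
  - by rewrite lat /anc2 connect0 orbT.
  apply/innerP => i lti; apply/implyP => ci.
  move: (it i lti); rewrite [collider_at _ _ _ _]ci => /exists_inP[z].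
  rewrite inE => /and3P[_ Az _] /mag_directed_sub vz.
  by case/orP: Az => /(connect_trans vz) H; rewrite /anc2 H ?orbT.
(* Inner vertices are observed ancestors other than [a] and [b], so they lie in [Z] and can only be
   passed as colliders. *)
have iat : inner (collider M) a t.
  apply/innerP => i lti; move: (it i lti).
  rewrite [collider_at _ _ _ _]/(collider _ _ _ _).
  case: ifP => // _ /negP[].
  case/andP: lti => i0 lti.
  have vt : nth a (a :: t) i \in a :: t by rewrite mem_nth // ltnS ltnW.
  rewrite inE (allP At _ vt).
  have -> /= : nth a (a :: t) i \in O.
    by move/pathP: pat => /(_ a i lti); case/adj_magE.
  have neq_nth j : j < size (a :: t) -> i != j ->
      nth a (a :: t) i != nth a (a :: t) j.
    by move=> ltj; rewrite nth_uniq // ltnS ltnW.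
  have /= -> := neq_nth 0 isT (lt0n_neq0 i0).
  by rewrite -lat (last_nth a); apply: neq_nth; rewrite ?ltnS // neq_ltn lti.
have [|w [pw lw _ Aw [iw _]]] := collider_path_walk pat _ iat At.
  by case: (t) lat neq => //= <-; rewrite eqxx.
by case/negP: nadj; apply/adj_magE; split=> //; apply: (inducing_walk pw _ Aw iw); rewrite lw.
Qed.

(** * Directed paths in the MAG and possible descendants *)

Lemma mag_in_pag_class : in_pag_class D O M.
Proof. by split; [exact: mag_is_MAG | move=> a b Z]. Qed.

(** A tail in the MAG, one member of the class, refutes an arrowhead common to all members. *)
Lemma mag_directed_PossDe x v : connect M.1 x v -> v \in PossDe D O x.
Proof.
rewrite inE; apply: connect_sub => u w uw; apply: connect1.
rewrite /possdir_edge /pag_adj /adj uw /=; apply/asboolPn => /(_ _ mag_in_pag_class).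
by move/mag_arrow; case/and5P: uw => _ _ _ _ ->.
Qed.

(* A directed path with latent interior vertices is an inducing path. *)
Lemma connect_mag x y : x \in O -> y \in O -> connect D x y -> connect M.1 x y.
Proof.
move=> xO yO /connectP[t]; have [n] := ubnP (size t).
elim: n t x xO => // n IH t x xO; rewrite ltnS => szt pxt yE.
case: t => [|z t] in szt pxt yE *; first by rewrite yE.
have : has (mem O) (z :: t).
  by apply/hasP; exists y => //; rewrite yE; exact: (mem_last z t).
(* The segment up to the first observed vertex [v] becomes one MAG edge; induction handles the
   rest. *)
move=> Ot; move: szt pxt yE; case/split_find: Ot => v s1 s2 vO s1O.
rewrite cat_path last_rcons last_cat last_rcons size_cat size_rcons.
move=> szt /andP[pxv pvs] yE.
apply: connect_trans (IH s2 v vO _ pvs yE); last by lia.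
have pd : forall w, w \in x :: rcons s1 v -> connect D w v.
  by move=> w /(path_connect_last pxv); rewrite last_rcons.
have [z0 Dxz zv] : exists2 w, D x w & connect D w v.
  case: (s1) pxv pd => [|w p] /= /andP[Dxw _] pd; [exists v | exists w] => //.
  by apply: pd; rewrite !inE eqxx orbT.
apply: connect1; rewrite /= xO; apply/and5P; split=> //.
- by apply/eqP => xv; move: (HD Dxz); rewrite xv zv.
- apply/asboolP/(@inducing_walk _ _ (rcons s1 v)).
  + by apply: sub_path pxv => p q pq; rewrite /adj /= pq.
  + by rewrite last_rcons.
  + by apply/allP => w /pd; rewrite /anc2 => ->; rewrite orbT.
  + apply/innerP => -[|i] //; rewrite size_rcons => /andP[_ lti].
    apply/implyP => /= vi; case/negP: s1O; apply/hasP.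
    exists (nth x s1 i); first exact: mem_nth.
    by rewrite nth_rcons (lti : i < size s1) in vi.
- by apply: pd; rewrite mem_head.
Qed.

(* The path is cut at its first vertex lying between [x] and [y], and continued
   by a directed path, whose vertices also lie between [x] and [y]. *)
Lemma mconnecting_extend s x y (Z : {set T}) :
  mconnecting M s x Z -> connect M.1 x y ->
  (forall v, connect M.1 x v -> v \notin Z) -> mconnecting M s y Z.
Proof.
move=> [t [/and3P[pst ust /eqP lst] ist]] xy nZ.
pose ok u v w := if collider M u v w then anc_of_set M v Z else v \notin Z.
have {}ist : inner ok s t by apply/innerP.
pose Q := [pred v | connect M.1 x v && connect M.1 v y].
(* A vertex left through a tail is no collider, whatever precedes it, and descendants of [x] avoid
   [Z]. *)
have okQ u p q : Q p -> M.1 p q -> ok u p q.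
  case/andP=> xp _ pq; rewrite /ok ifF; first exact: nZ.
  apply/negP => /andP[_ /mag_arrow]; by case/and5P: pq => _ _ _ _ ->.
have Qpath v : v \in Q -> exists r,
    [/\ path (adj M) v r, uniq (v :: r), last v r = y, all Q (v :: r) &
    inner ok v r /\ forall u, if r is w :: _ then ok u v w else true].
  move=> Qv; case/andP: (Qv) => xv /connectP[r0 pr0 yE].
  case/shortenP: pr0 yE => r pr ur _ yE; exists r.
  have Qr w : w \in v :: r -> Q w.
    move=> wr; rewrite /= (connect_trans xv (path_connect pr wr)) yE.
    exact: path_connect_last.
  split=> //; first by apply: sub_path pr => p q pq; rewrite /adj pq.
    exact/allP.
  split; last by case: (r) pr => //= w r' /andP[vw _] u; apply: okQ.
  apply/innerP => i /andP[_ lti]; apply: okQ; first by apply/Qr/mem_nth/ltnW.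
  exact: (pathP v pr).
have Qst : has Q (s :: t).
  apply/hasP; exists x; first by rewrite -lst; exact: mem_last.
  by rewrite /= connect0.
suff [r [psr usr lsr isr]] : exists r,
    [/\ path (adj M) s r, uniq (s :: r), last s r = y & inner ok s r].
  exists r; split; first by rewrite /gpath psr usr lsr eqxx.
  exact: (innerP ok s r isr).
have [Qs|nQs] := boolP (Q s).
  by have [r [? ? ? _ [? _]]] := Qpath s Qs; exists r.
have {Qst} Qt : has Q t by move: Qst => /orP[Qs|//]; case/negP: nQs.
move: pst ust ist {lst}; case/split_find: Qt => v p q Qv nQp.
rewrite cat_path => /andP[psv _] usp /inner_catl isv.
have [r [pvr uvr lvr Qr [ivr okr]]] := Qpath v Qv.
exists (rcons p v ++ r); split.
- by rewrite cat_path psv last_rcons.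
(* The two pieces meet only in [v]: earlier vertices are outside [Q], the continuation inside. *)
- rewrite -cat_cons cat_uniq; apply/and3P; split.
  + by move: usp; rewrite -cat_cons cat_uniq => /andP[].
  + apply/hasPn => w wr; have Qw : Q w by apply: (allP Qr); rewrite inE wr orbT.
    rewrite !inE mem_rcons inE !negb_or; apply/and3P; split.
    * by apply: contra nQs => /eqP <-.
    * by apply: contraL wr => /eqP->; case/andP: uvr.
    * by apply: contra nQp => wp; apply/hasP; exists w.
  + by case/andP: uvr.
- by rewrite last_cat last_rcons.
case: r ivr okr {pvr uvr lvr Qr} => [|w r] ivr okr; first by rewrite cats0.
by rewrite inner_cat isv okr.
Qed.

End MarginalMAG.

Theorem theorem4 (T : finType) (D : rel T) (O : {set T})
  (indep : {set T} -> {set T} -> {set T} -> Prop)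
  (HD : acyclic_dag D) (Hci : ci_matches_mag D O indep)
  (X Y : T) (HX : X \in O) (HY : Y \in O) (HXY : X != Y)
  (MB : {set T}) (HMB : is_markov_blanket O indep X MB) :
  (exists (Z : {set T}) (S : T),
      [/\ Z \subset MB, [disjoint Z & PossDe D O X],
          S \in MB :\: (Y |: pag_Ch D O X) &
          (indep [set X] [set Y] Z \/
           (~ indep [set S] [set X] Z /\ indep [set S] [set Y] Z))]) ->
  no_causal_effect D X Y.
Proof.
move=> [Z [S [sZ dZ /setDP[SMB _] ind]]]; apply/negP => /(connect_mag HD HX HY) XY.
have {HMB} sMB : MB \subset O by case: HMB => -[/subset_trans->] //; exact: subD1set.
have sZO := subset_trans sZ sMB.
have nZ v : connect (mag_of D O).1 X v -> v \notin Z.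
  by move/(mag_directed_PossDe HD) => vP; rewrite (disjointFl dZ vP).
have indepE a b : a \in O -> b \in O -> indep [set a] [set b] Z <-> msep (mag_of D O) a b Z.
  move=> aO bO; rewrite Hci ?sub1set //; split=> [|h u v /set1P-> /set1P->//].
  by apply; rewrite set11.
(* This excludes the separations that hold trivially because an endpoint is in [Z]. *)
have XnZ := negP (nZ X (connect0 _ _)); have YnZ := negP (nZ Y XY).
case: ind => [/(indepE _ _ HX HY)[|[]]//|[nSX /(indepE _ _ (subsetP sMB _ SMB) HY)]].
  apply; apply: (mconnecting_extend HD _ XY nZ).
  (* In case (i) the path to be extended is the trivial one at [X]. *)
  by exists [::]; split; [rewrite /gpath /= eqxx | case=> [|i]].
case=> [SZ|[|nSY]//]; apply: nSX.
  by apply/(indepE _ _ (subsetP sMB _ SMB) HX); left.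
apply/(indepE _ _ (subsetP sMB _ SMB) HX); right; right=> SX.
exact: nSY (mconnecting_extend HD SX XY nZ).
Qed.
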